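(* Let $K$ be a field, let $L_n$ be an $n$-dimensional null-filiform Leibniz algebra over $K$, and let $f(x_1,\dots,x_m)\in\mathcal D(X)$ be a multilinear polynomial in the variables $x_1,\dots,x_m$. Then the image of $f$ on $L_n$ is $\{0\}$, $(L_n)^m$ or $(L_n)^{m+1}$. In particular, the image of $f$ is a vector subspace of $L_n$.
   Context: A Leibniz algebra over $K$ is a (not necessarily associative) $K$-algebra satisfying $x(yz)=(xy)z-(xz)y$ for all $x,y,z$. For a Leibniz algebra $L$ put $L^1=L$ and $L^{k+1}=L^kL$. An $n$-dimensional Leibniz algebra $L$ is null-filiform if $\dim L^i=n+1-i$ for $1\le i\le n+1$. It is known that every $n$-dimensional null-filiform Leibniz algebra is isomorphic to the algebra with basis $e_1,\dots,e_n$ and products $e_ie_1=e_{i+1}$ for $1\le i\le n-1$, all other products of basis elements being zero. $\mathcal D(X)$ is the free Leibniz $K$-algebra on $X=\{x_1,x_2,\dots\}$; its elements are called polynomials. A polynomial in $x_1,\dots,x_m$ is multilinear if it is a linear combination of the left-normed monomials $x_{\sigma(1)}x_{\sigma(2)}\cdots x_{\sigma(m)}=(\cdots(x_{\sigma(1)}x_{\sigma(2)})\cdots)x_{\sigma(m)}$, $\sigma\in S_m$. The image of $f(x_1,\dots,x_m)$ on $L$ is $\{f(a_1,\dots,a_m): a_1,\dots,a_m\in L\}$. *)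

(* Defs.v *)
From HB Require Import structures.
From mathcomp Require Import all_boot all_order all_algebra all_fingroup.
From mathcomp Require Import generic_quotient.
From mathcomp Require Import boolp classical_sets.

Set Implicit Arguments.
Unset Strict Implicit.
Unset Printing Implicit Defensive.

Import GRing.Theory.

Local Open Scope ring_scope.
Local Open Scope quotient_scope.
Local Open Scope classical_set_scope.

Reserved Notation "x ** y" (at level 40, left associativity).

HB.mixin Record Lmodule_isLeibniz (K : fieldType) V of GRing.Lmodule K V := {
  lbmul : V -> V -> V;
  lbmul_linearl : forall y : V, linear (fun x => lbmul x y);
  lbmul_linearr : forall x : V, linear (lbmul x);
  lbmul_leibniz : forall x y z : V,
    lbmul x (lbmul y z) = lbmul (lbmul x y) z - lbmul (lbmul x z) y
}.

#[short(type="leibnizType")]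
HB.structure Definition Leibniz (K : fieldType) :=
  {V of Lmodule_isLeibniz K V & GRing.Lmodule K V}.

#[short(type="leibnizVectType")]
HB.structure Definition LeibnizVect (K : fieldType) :=
  {V of Leibniz K V & Vector K V}.

Declare Scope leibniz_scope.
Delimit Scope leibniz_scope with LB.
Notation "x ** y" := (lbmul x y) : leibniz_scope.
Local Open Scope leibniz_scope.

Section LeibnizTheory.
Variables (K : fieldType) (V : leibnizType K).
Implicit Types (x y z : V) (a : K).

Lemma lbmulDl x y z : (x + y) ** z = x ** z + y ** z.
Proof. by have := lbmul_linearl z 1 x y; rewrite !scale1r. Qed.

Lemma lbmulDr x y z : x ** (y + z) = x ** y + x ** z.
Proof. by have := lbmul_linearr x 1 y z; rewrite !scale1r. Qed.

Lemma lbmul0r x : 0 ** x = 0.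
Proof. by apply: (addrI (0 ** x)); rewrite -lbmulDl !addr0. Qed.

Lemma lbmulr0 x : x ** 0 = 0.
Proof. by apply: (addrI (x ** 0)); rewrite -lbmulDr !addr0. Qed.

Lemma lbmulZl a x y : (a *: x) ** y = a *: (x ** y).
Proof. by have := lbmul_linearl y a x 0; rewrite lbmul0r !addr0. Qed.

Lemma lbmulZr a x y : x ** (a *: y) = a *: (x ** y).
Proof. by have := lbmul_linearr x a y 0; rewrite lbmulr0 !addr0. Qed.

(* The left-normed product (..((s_0 s_1) s_2)..) s_k; the value on the empty
   sequence is a dummy. *)
Definition lnormed (s : seq V) : V :=
  if s is x :: s' then foldl lbmul x s' else 0.

End LeibnizTheory.

Section LowerCentralSeries.
Variables (K : fieldType) (L : leibnizVectType K).

(* The subspace spanned by the products of elements of U by elements of W; as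
   the product is bilinear, products of basis vectors suffice. *)
Definition lbprodv (U W : {vspace L}) : {vspace L} :=
  <<[seq u ** w | u <- vbasis U, w <- vbasis W]>>%VS.

Lemma memv_lbmul (U W : {vspace L}) u w :
  u \in U -> w \in W -> u ** w \in lbprodv U W.
Proof.
move=> /coord_vbasis-> /coord_vbasis->.
rewrite (big_morph (fun x => x ** _) (fun x y => lbmulDl x y _) (lbmul0r _)).
apply: memv_suml => i _.
rewrite (big_morph (lbmul _) (lbmulDr _) (lbmulr0 _)).
apply: memv_suml => j _; rewrite lbmulZl lbmulZr !memvZ // memv_span //.
by apply: allpairs_f; apply: mem_nth; rewrite size_tuple.
Qed.

Lemma lbprodvP (U W X : {vspace L}) :
  reflect (forall u w, u \in U -> w \in W -> u ** w \in X)
          (lbprodv U W <= X)%VS.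
Proof.
apply: (iffP idP) => [/subvP sX u w Uu Ww | sX].
  by apply: sX; apply: memv_lbmul.
apply/span_subvP => _ /allpairsP[[u w] /= [Uu Ww ->]].
by apply: sX; apply: vbasis_mem.
Qed.

(* L^k for k >= 1, with L^1 = L and L^(k+1) = L^k L; the value at k = 0 is a
   dummy. *)
Definition lbpow (k : nat) : {vspace L} :=
  iter k.-1 (fun U => lbprodv U fullv) fullv.

Lemma lbpow1 : lbpow 1 = fullv. Proof. by []. Qed.

Lemma lbpowS k : (0 < k)%N -> lbpow k.+1 = lbprodv (lbpow k) fullv.
Proof. by case: k. Qed.

Definition null_filiform (n : nat) : Prop :=
  \dim {:L} = n /\
  forall i : nat, (1 <= i <= n.+1)%N -> \dim (lbpow i) = (n.+1 - i)%N.

End LowerCentralSeries.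

(* The free Leibniz algebra on X = {x_0, x_1, ...}: formal expressions modulo
   the congruence generated by the axioms of Leibniz K-algebras. *)
Inductive lterm (K : Type) : Type :=
| LVar of nat
| LZero
| LOpp of lterm K
| LAdd of lterm K & lterm K
| LScale of K & lterm K
| LMul of lterm K & lterm K.
Arguments LVar {K}.
Arguments LZero {K}.

Inductive lterm_eq (K : fieldType) : lterm K -> lterm K -> Prop :=
| Leq_refl t : lterm_eq t t
| Leq_sym t u : lterm_eq t u -> lterm_eq u t
| Leq_trans t u v : lterm_eq t u -> lterm_eq u v -> lterm_eq t v
| Leq_opp t t' : lterm_eq t t' -> lterm_eq (LOpp t) (LOpp t')
| Leq_add t t' u u' :
    lterm_eq t t' -> lterm_eq u u' -> lterm_eq (LAdd t u) (LAdd t' u')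
| Leq_scale a t t' : lterm_eq t t' -> lterm_eq (LScale a t) (LScale a t')
| Leq_mul t t' u u' :
    lterm_eq t t' -> lterm_eq u u' -> lterm_eq (LMul t u) (LMul t' u')
| Leq_addA t u v : lterm_eq (LAdd t (LAdd u v)) (LAdd (LAdd t u) v)
| Leq_addC t u : lterm_eq (LAdd t u) (LAdd u t)
| Leq_add0 t : lterm_eq (LAdd LZero t) t
| Leq_addN t : lterm_eq (LAdd (LOpp t) t) LZero
| Leq_scaleA a b t : lterm_eq (LScale a (LScale b t)) (LScale (a * b) t)
| Leq_scale1 t : lterm_eq (LScale 1 t) t
| Leq_scaleDr a t u :
    lterm_eq (LScale a (LAdd t u)) (LAdd (LScale a t) (LScale a u))
| Leq_scaleDl a b t :
    lterm_eq (LScale (a + b) t) (LAdd (LScale a t) (LScale b t))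
| Leq_mull a t u v :
    lterm_eq (LMul (LAdd (LScale a t) u) v)
             (LAdd (LScale a (LMul t v)) (LMul u v))
| Leq_mulr a t u v :
    lterm_eq (LMul v (LAdd (LScale a t) u))
             (LAdd (LScale a (LMul v t)) (LMul v u))
| Leq_leibniz t u v :
    lterm_eq (LMul t (LMul u v))
             (LAdd (LMul (LMul t u) v) (LOpp (LMul (LMul t v) u))).

HB.instance Definition _ (K : fieldType) := gen_eqMixin (lterm K).
HB.instance Definition _ (K : fieldType) := gen_choiceMixin (lterm K).

Section FreeLeibniz.
Variable K : fieldType.
Implicit Types t u v : lterm K.

Definition lterm_eqb t u : bool := `[< lterm_eq t u >].

Lemma lterm_eqb_refl : reflexive lterm_eqb.
Proof. by move=> t; apply/asboolP; apply: Leq_refl. Qed.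

Lemma lterm_eqb_sym : symmetric lterm_eqb.
Proof. by move=> t u; apply/asboolP/asboolP; apply: Leq_sym. Qed.

Lemma lterm_eqb_trans : transitive lterm_eqb.
Proof.
by move=> u t v /asboolP tu /asboolP uv; apply/asboolP; apply: Leq_trans uv.
Qed.

Canonical lterm_equiv :=
  EquivRel lterm_eqb lterm_eqb_refl lterm_eqb_sym lterm_eqb_trans.

Definition freeLeibniz := {eq_quot lterm_equiv}.

HB.instance Definition _ := Choice.on freeLeibniz.
HB.instance Definition _ := EqQuotient.on freeLeibniz.

Definition fl_pi t : freeLeibniz := \pi_freeLeibniz t.

Lemma fl_piP t u : fl_pi t = fl_pi u <-> lterm_eq t u.
Proof.
split=> [/eqmodP/asboolP // | tu].
by apply/eqmodP/asboolP.
Qed.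

Lemma fl_reprK (f : freeLeibniz) : fl_pi (repr f) = f.
Proof. exact: reprK. Qed.

Lemma fl_repr_pi t : lterm_eq (repr (fl_pi t)) t.
Proof. by apply/fl_piP; rewrite fl_reprK. Qed.

Definition fl_var (i : nat) : freeLeibniz := fl_pi (LVar i).
Definition fl_zero : freeLeibniz := fl_pi LZero.
Definition fl_opp (f : freeLeibniz) := fl_pi (LOpp (repr f)).
Definition fl_add (f g : freeLeibniz) := fl_pi (LAdd (repr f) (repr g)).
Definition fl_scale (a : K) (f : freeLeibniz) := fl_pi (LScale a (repr f)).
Definition fl_mul (f g : freeLeibniz) := fl_pi (LMul (repr f) (repr g)).

Lemma fl_oppE t : fl_opp (fl_pi t) = fl_pi (LOpp t).
Proof. by apply/fl_piP; apply: Leq_opp (fl_repr_pi t). Qed.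

Lemma fl_addE t u : fl_add (fl_pi t) (fl_pi u) = fl_pi (LAdd t u).
Proof. by apply/fl_piP; apply: Leq_add (fl_repr_pi t) (fl_repr_pi u). Qed.

Lemma fl_scaleE a t : fl_scale a (fl_pi t) = fl_pi (LScale a t).
Proof. by apply/fl_piP; apply: Leq_scale (fl_repr_pi t). Qed.

Lemma fl_mulE t u : fl_mul (fl_pi t) (fl_pi u) = fl_pi (LMul t u).
Proof. by apply/fl_piP; apply: Leq_mul (fl_repr_pi t) (fl_repr_pi u). Qed.

Let flE := (fl_oppE, fl_addE, fl_scaleE, fl_mulE).

Fact fl_addA : associative fl_add.
Proof.
move=> f g h; rewrite -(fl_reprK f) -(fl_reprK g) -(fl_reprK h) !flE.
by apply/fl_piP; apply: Leq_addA.
Qed.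

Fact fl_addC : commutative fl_add.
Proof. by move=> f g; apply/fl_piP; apply: Leq_addC. Qed.

Fact fl_add0 : left_id fl_zero fl_add.
Proof.
by move=> f; rewrite -(fl_reprK f) !flE; apply/fl_piP; apply: Leq_add0.
Qed.

Fact fl_addN : left_inverse fl_zero fl_opp fl_add.
Proof.
by move=> f; rewrite -(fl_reprK f) !flE; apply/fl_piP; apply: Leq_addN.
Qed.

HB.instance Definition _ :=
  GRing.isZmodule.Build freeLeibniz fl_addA fl_addC fl_add0 fl_addN.

Fact fl_scaleA a b f : fl_scale a (fl_scale b f) = fl_scale (a * b) f.
Proof. by rewrite -(fl_reprK f) !flE; apply/fl_piP; apply: Leq_scaleA. Qed.

Fact fl_scale1 : left_id 1 fl_scale.
Proof.
by move=> f; rewrite -(fl_reprK f) !flE; apply/fl_piP; apply: Leq_scale1.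
Qed.

Fact fl_scaleDr : right_distributive fl_scale +%R.
Proof.
move=> a f g; rewrite -(fl_reprK f) -(fl_reprK g) /+%R /= !flE.
by apply/fl_piP; apply: Leq_scaleDr.
Qed.

Fact fl_scaleDl f : {morph fl_scale^~ f : a b / a + b}.
Proof.
move=> a b; rewrite -(fl_reprK f) {2}/+%R /= !flE.
by apply/fl_piP; apply: Leq_scaleDl.
Qed.

HB.instance Definition _ := GRing.Zmodule_isLmodule.Build K freeLeibniz
  fl_scaleA fl_scale1 fl_scaleDr fl_scaleDl.

Fact fl_mul_linearl (h : freeLeibniz) : linear (fun f => fl_mul f h).
Proof.
move=> a f g; rewrite -(fl_reprK f) -(fl_reprK g) -(fl_reprK h).
rewrite /+%R /*:%R /= !flE.
by apply/fl_piP; apply: Leq_mull.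
Qed.

Fact fl_mul_linearr (h : freeLeibniz) : linear (fl_mul h).
Proof.
move=> a f g; rewrite -(fl_reprK f) -(fl_reprK g) -(fl_reprK h).
rewrite /+%R /*:%R /= !flE.
by apply/fl_piP; apply: Leq_mulr.
Qed.

Fact fl_mul_leibniz (f g h : freeLeibniz) :
  fl_mul f (fl_mul g h) = fl_mul (fl_mul f g) h - fl_mul (fl_mul f h) g.
Proof.
rewrite -(fl_reprK f) -(fl_reprK g) -(fl_reprK h) /+%R /-%R /= !flE.
by apply/fl_piP; apply: Leq_leibniz.
Qed.

HB.instance Definition _ := Lmodule_isLeibniz.Build K freeLeibniz
  fl_mul_linearl fl_mul_linearr fl_mul_leibniz.

End FreeLeibniz.

Arguments fl_var K i : clear implicits.

Section Evaluation.
Variables (K : fieldType) (L : leibnizType K).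

Fixpoint lterm_eval (a : nat -> L) (t : lterm K) : L :=
  match t with
  | LVar i => a i
  | LZero => 0
  | LOpp t => - lterm_eval a t
  | LAdd t u => lterm_eval a t + lterm_eval a u
  | LScale c t => c *: lterm_eval a t
  | LMul t u => lterm_eval a t ** lterm_eval a u
  end.

Definition fl_eval (a : nat -> L) (f : freeLeibniz K) : L :=
  lterm_eval a (repr f).

Lemma lterm_eval_eq a t u : lterm_eq t u -> lterm_eval a t = lterm_eval a u.
Proof.
elim=> {t u} //=; try congruence.
- by move=> t u v; rewrite addrA.
- by move=> t u; rewrite addrC.
- by move=> t; rewrite add0r.
- by move=> t; rewrite addNr.
- by move=> c d t; rewrite scalerA.
- by move=> t; rewrite scale1r.
- by move=> c t u; rewrite scalerDr.
- by move=> c d t; rewrite scalerDl.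
- by move=> c t u v; rewrite lbmulDl lbmulZl.
- by move=> c t u v; rewrite lbmulDr lbmulZr.
- by move=> t u v; rewrite lbmul_leibniz.
Qed.

Lemma fl_eval_pi a t : fl_eval a (fl_pi t) = lterm_eval a t.
Proof. exact/lterm_eval_eq/fl_repr_pi. Qed.

(* The universal property: fl_eval a is the unique homomorphism of Leibniz
   algebras mapping x_i to a i. *)
Lemma fl_eval_var a i : fl_eval a (fl_var K i) = a i.
Proof. exact: fl_eval_pi. Qed.

Lemma fl_eval_linear a : linear (fl_eval a).
Proof.
move=> c f g; rewrite -(fl_reprK f) -(fl_reprK g).
rewrite {1}/+%R {1}/*:%R /= fl_scaleE fl_addE.
by rewrite !fl_eval_pi.
Qed.

Lemma fl_eval_mul a f g : fl_eval a (f ** g) = fl_eval a f ** fl_eval a g.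
Proof.
rewrite -(fl_reprK f) -(fl_reprK g) {1}/lbmul /= fl_mulE.
by rewrite !fl_eval_pi.
Qed.

Lemma fl_eval_unique a (phi : freeLeibniz K -> L) :
  linear phi -> (forall f g, phi (f ** g) = phi f ** phi g) ->
  (forall i, phi (fl_var K i) = a i) -> phi =1 fl_eval a.
Proof.
move=> phi_lin phiM phi_var f.
have phiD g h : phi (g + h) = phi g + phi h.
  by have := phi_lin 1 g h; rewrite !scale1r.
have phi0 : phi 0 = 0 by apply: (addrI (phi 0)); rewrite -phiD !addr0.
have phiZ c g : phi (c *: g) = c *: phi g.
  by have := phi_lin c g 0; rewrite phi0 !addr0.
rewrite -(fl_reprK f) fl_eval_pi.
elim: (repr f) => /= [i||t|t IHt u IHu|c t|t IHt u IHu].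
- exact: phi_var.
- exact: phi0.
- have -> : fl_pi (LOpp t) = - fl_pi t by exact: esym (fl_oppE t).
  by move<-; rewrite -scaleN1r phiZ scaleN1r.
- by rewrite -IHt -IHu -fl_addE -phiD.
- by move<-; rewrite -fl_scaleE -phiZ.
- by rewrite -IHt -IHu -fl_mulE -phiM.
Qed.

(* The image of f, seen as a polynomial in the variables x_0, ..., x_(m-1).
   The remaining variables are sent to 0, which is irrelevant when f does not
   involve them. *)
Definition fl_image (m : nat) (f : freeLeibniz K) : set L :=
  [set v | exists a : m.-tuple L, v = fl_eval (nth 0 a) f].

End Evaluation.

Arguments fl_image {K} L m f.

Definition multilinear (K : fieldType) (m : nat) (f : freeLeibniz K) : Prop :=
  exists alpha : 'S_m -> K,
    f = \sum_(s : 'S_m)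
          alpha s *: lnormed [seq fl_var K (s i) | i : 'I_m].

(* Main.v *)
Require Import Defs.
From HB Require Import structures.
From mathcomp Require Import all_boot all_order all_algebra all_fingroup.
From mathcomp Require Import boolp classical_sets.

(** Let [L] be null-filiform and [L^k] its lower central series.

    Since [L^2] has codimension at most one, [L = K e + L^2] for some [e]
    ([codim1_generator]).  Such an [L] is generated by [e], in the strong sense
    that [L^k = K e^k + L^(k+1)] for the left-normed powers [e^k]
    ([lbpow_sub_power]).  The Leibniz identity gives [x (e e) = 0], and it shows
    that the right annihilator is stable under right multiplication; hence every
    [e^k] with [k >= 2] annihilates [L] from the right, and so does [L^2],
    because [L^(n+1) = 0] ([lbpow2_right_annihilates]).

    Write [R] for the right multiplication by [e].  An element [t e + w] with
    [w] in [L^2] then multiplies from the right as [t R], so that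
    [L^(j+k) = R^k (L^j)] ([mem_lbpow_iter]), and a multilinear [f] of degree
    [m + 1] takes at [a_i = t_i e + w_i] the value
      [R^m (\sum_j (c_j \prod_(i != j) t_i) a_j)],
    where [c_j] adds the coefficients of the monomials starting with [x_j]
    ([eval_multilinear]).  The coefficient of [e] in the argument of [R^m] is
    [(\sum_j c_j) \prod_i t_i].  If all [c_j] vanish, the image is zero.
    Otherwise fix [c_k != 0] and let [a_i = e] for [i != k]: the argument is
    [c_k w_k] up to a multiple of [e], so every element of [L^2] is reached
    (with [t_k = 0]), and every element of [L] if moreover [\sum_j c_j != 0].
    If [\sum_j c_j = 0], the argument always lies in [L^2].  The image is
    therefore [R^m (L) = L^(m+1)] or [R^m (L^2) = L^(m+2)]. *)

Set Implicit Arguments.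
Unset Strict Implicit.
Unset Printing Implicit Defensive.

Import GRing.Theory.
Local Open Scope ring_scope.
Local Open Scope classical_set_scope.
Local Open Scope leibniz_scope.

(** * Multiplications as linear maps *)

Definition rmul (K : fieldType) (L : leibnizType K) (e x : L) : L := x ** e.

HB.instance Definition _ (K : fieldType) (L : leibnizType K) (e : L) :=
  GRing.isLinear.Build K L L *:%R (rmul e) (lbmul_linearl e).

HB.instance Definition _ (K : fieldType) (L : leibnizType K) (x : L) :=
  GRing.isLinear.Build K L L *:%R (lbmul x) (lbmul_linearr x).

Fact iter_linear (K : fieldType) (V : lmodType K) (g : {linear V -> V})
    (k : nat) : linear (iter k g).
Proof. by move=> c x y; elim: k => //= k ->; rewrite linearP. Qed.

HB.instance Definition _ (K : fieldType) (V : lmodType K)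
    (g : {linear V -> V}) (k : nat) :=
  GRing.isLinear.Build K V V *:%R (iter k g) (iter_linear g k).

(** * The lower central series of a one-generated algebra *)

Lemma mem_lbpow_mul (K : fieldType) (L : leibnizVectType K) (k : nat) (x y : L) :
  x \in lbpow L k.+1 -> x ** y \in lbpow L k.+2.
Proof. by move=> xk; rewrite lbpowS // memv_lbmul ?memvf. Qed.

(** The Leibniz identity turns a right factor from [L^2] into two successive
    right factors, so it gains two steps in the series. *)
Lemma mem_lbpow_mul2 (K : fieldType) (L : leibnizVectType K) (k : nat)
    (x w : L) :
  x \in lbpow L k.+1 -> w \in lbpow L 2 -> x ** w \in lbpow L k.+3.
Proof.
move=> xk; pose P := (linfun (lbmul x) @^-1: lbpow L k.+3)%VS.
suff /subvP sP : (lbpow L 2 <= P)%VS.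
  by move=> /sP; rewrite -memv_preim lfunE.
rewrite lbpowS //; apply/lbprodvP => y z _ _.
by rewrite -memv_preim lfunE /= lbmul_leibniz memvB ?mem_lbpow_mul.
Qed.

Lemma lbpow_null (K : fieldType) (L : leibnizVectType K) (k d : nat) :
  lbpow L k.+1 = 0%VS -> lbpow L (k + d).+1 = 0%VS.
Proof.
move=> Lk0; elim: d => [|d IHd]; first by rewrite addn0.
rewrite addnS lbpowS // IHd; apply/eqP; rewrite -subv0.
by apply/lbprodvP => u w; rewrite memv0 => /eqP -> _; rewrite lbmul0r mem0v.
Qed.

(** A complement of [L^2] has dimension at most one, so it is spanned by the
    vector picked in it; that vector is zero when [L] is. *)
Lemma codim1_generator (K : fieldType) (L : leibnizVectType K) (n : nat) :
  null_filiform L n -> exists e : L, ({:L} <= <[e]> + lbpow L 2)%VS.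
Proof.
move=> [dimL dimpow]; exists (vpick (lbpow L 2)^C).
have dimC : (\dim (lbpow L 2)^C <= 1)%N.
  rewrite dimv_compl dimL; case: n dimL dimpow => // n _ -> //.
  by rewrite !subSS subn0 subSnn.
have CE : ((lbpow L 2)^C <= <[vpick (lbpow L 2)^C]>)%VS.
  have [->|nz] := eqVneq ((lbpow L 2)^C)%VS 0%VS; first exact: sub0v.
  rewrite -(geq_leqif (dimv_leqif_sup _)) -?memvE ?memv_pick //.
  by rewrite dim_vline vpick0 nz.
by rewrite -(addv_complf (lbpow L 2)) addvC addvS.
Qed.

Lemma mem_generated (K : fieldType) (L : leibnizVectType K) (e : L) :
  ({:L} <= <[e]> + lbpow L 2)%VS ->
  forall x : L, exists t : K, x - t *: e \in lbpow L 2.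
Proof.
move=> /subvP gen x; have /memv_addP[_ /vlineP[t ->] [w Lw ->]] := gen x (memvf x).
by exists t; rewrite addrC addKr.
Qed.

(** The powers [e^k] span the successive quotients of the series: in the product
    of [c e^k + u] by [t e + w], all terms but [c t e^(k+1)] lie in
    [L^(k+2)]. *)
Lemma lbpow_sub_power (K : fieldType) (L : leibnizVectType K) (e : L) (k : nat) :
  ({:L} <= <[e]> + lbpow L 2)%VS ->
  (lbpow L k.+1 <= <[iter k (rmul e) e]> + lbpow L k.+2)%VS.
Proof.
move=> gen; elim: k => [|k IHk] //.
rewrite lbpowS //; apply/lbprodvP => x y xk _.
have [t yL] := mem_generated gen y.
have /memv_addP[_ /vlineP[c ->] [u uk xE]] := subvP IHk x xk.
rewrite -[y](subrK (t *: e)) lbmulDr addrC lbmulZr {1}xE lbmulDl lbmulZl scalerDr.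
rewrite -addrA memv_add ?memvD ?memvZ ?memv_line //.
  exact: mem_lbpow_mul.
exact: mem_lbpow_mul2.
Qed.

(** For [e e], the two terms of the Leibniz identity coincide. For a higher power
    [e^k e], both of them contain a product by [e^k] on the right,
    which vanishes by induction. *)
Lemma lbmul_power0 (K : fieldType) (L : leibnizType K) (e x : L) (k : nat) :
  x ** iter k.+1 (rmul e) e = 0.
Proof.
elim: k x => [|k IHk] x; first by rewrite /= lbmul_leibniz subrr.
by rewrite iterS {1}/rmul lbmul_leibniz !IHk lbmul0r subrr.
Qed.

Lemma lbpow2_right_annihilates (K : fieldType) (L : leibnizVectType K) (n : nat)
    (e : L) :
  null_filiform L n -> ({:L} <= <[e]> + lbpow L 2)%VS ->
  forall x w : L, w \in lbpow L 2 -> x ** w = 0.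
Proof.
move=> [_ dimpow] gen x.
have Ln0 : lbpow L n.+1 = 0%VS.
  by apply/eqP; rewrite -dimv_eq0 dimpow ?subnn ?leqnn.
(* Descending induction along the series, d bounding the distance to a zero term. *)
suff ann d k w : (n <= k.+1 + d)%N -> w \in lbpow L k.+2 -> x ** w = 0.
  by move=> w; apply: (ann n); rewrite leq_addl.
elim: d k w => [|d IHd] k w.
  rewrite addn0 => le_nk; rewrite -(subnKC le_nk) lbpow_null // memv0.
  by move=> /eqP ->; rewrite lbmulr0.
rewrite addnS -addSn => le_nkd /(subvP (lbpow_sub_power _ gen)).
move=> /memv_addP[_ /vlineP[c ->] [u uk ->]].
by rewrite lbmulDr lbmulZr lbmul_power0 scaler0 add0r; apply: (IHd k.+1).
Qed.

(** Right multiplication by [y] only sees [y] modulo [L^2]. *)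
Lemma lbmul_generated (K : fieldType) (L : leibnizVectType K) (e : L) :
  (forall x w : L, w \in lbpow L 2 -> x ** w = 0) ->
  forall (x y : L) (t : K), y - t *: e \in lbpow L 2 -> x ** y = t *: rmul e x.
Proof.
by move=> ann x y t yL; rewrite -[y](subrK (t *: e)) lbmulDr ann // add0r lbmulZr.
Qed.

(** A product [x y] equals [R (t x)] for some scalar [t], so [R] maps each term
    of the series onto the next one, without passing to spans. *)
Lemma mem_lbpow_iter (K : fieldType) (L : leibnizVectType K) (e : L)
    (gen : ({:L} <= <[e]> + lbpow L 2)%VS)
    (ann : forall x w : L, w \in lbpow L 2 -> x ** w = 0) (j k : nat) (v : L) :
  v \in lbpow L (j.+1 + k) <->
  exists2 u, u \in lbpow L j.+1 & v = iter k (rmul e) u.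
Proof.
elim: k v => [|k IHk] v.
  by rewrite addn0; split=> [vj | [u uj ->]] //; exists v.
rewrite addnS; split=> [|[u uj ->]]; last first.
  by apply: mem_lbpow_mul; apply/IHk; exists u.
have /subvP sub : (lbpow L (j.+1 + k).+1 <=
    linfun (rmul e) @: lbpow L (j.+1 + k))%VS.
  rewrite lbpowS //; apply/lbprodvP => x y xjk _.
  have [t yL] := mem_generated gen y.
  by rewrite (lbmul_generated ann _ yL) memvZ // -lfunE memv_img.
move=> /sub/memv_imgP[w /IHk[u uj ->] ->].
by exists u; rewrite // lfunE.
Qed.

(** * Values of multilinear polynomials *)

Lemma fl_eval_lnormed (K : fieldType) (L : leibnizType K) (a : nat -> L)
    (s : seq (freeLeibniz K)) : fl_eval a (lnormed s) = lnormed (map (fl_eval a) s).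
Proof.
have ev0 : fl_eval a 0 = 0 by exact: fl_eval_pi.
case: s => //= x s; elim: s x => //= y s IHs x.
by rewrite IHs fl_eval_mul.
Qed.

Lemma fl_eval_sum (K : fieldType) (L : leibnizType K) (a : nat -> L)
    (I : finType) (alpha : I -> K) (g : I -> freeLeibniz K) :
  fl_eval a (\sum_i alpha i *: g i) = \sum_i alpha i *: fl_eval a (g i).
Proof.
have ev0 : fl_eval a 0 = 0 by exact: fl_eval_pi.
elim/big_rec2: _ => // i y x _ <-; exact: fl_eval_linear.
Qed.

Lemma foldl_generated (K : fieldType) (L : leibnizVectType K) (e : L)
    (ann : forall x w : L, w \in lbpow L 2 -> x ** w = 0)
    (I : Type) (a : I -> L) (t : I -> K)
    (at_e : forall i, a i - t i *: e \in lbpow L 2) (r : seq I) (x : L) :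
  foldl lbmul x (map a r) =
  (\prod_(i <- r) t i) *: iter (size r) (rmul e) x.
Proof.
elim: r x => [|i r IHr] x; first by rewrite big_nil scale1r.
rewrite /= IHr big_cons (lbmul_generated ann _ (at_e i)).
by rewrite linearZ scalerA mulrC -iterS iterSr.
Qed.

(** The monomial of [s] starts with the variable of index [s ord0]. *)
Definition head_coef (K : fieldType) (m : nat) (alpha : 'S_m.+1 -> K)
  (j : 'I_m.+1) : K := \sum_(s : 'S_m.+1 | s ord0 == j) alpha s.

(** A monomial only remembers its first letter: the other ones contribute the
    scalars [t_i], in any order. *)
Lemma eval_multilinear (K : fieldType) (L : leibnizVectType K) (e : L)
    (ann : forall x w : L, w \in lbpow L 2 -> x ** w = 0)
    (m : nat) (alpha : 'S_m.+1 -> K)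
    (b : nat -> L) (t : 'I_m.+1 -> K)
    (bt_e : forall i : 'I_m.+1, b i - t i *: e \in lbpow L 2) :
  fl_eval b (\sum_(s : 'S_m.+1)
       alpha s *: lnormed [seq fl_var K (s i) | i : 'I_m.+1]) =
  iter m (rmul e)
    (\sum_j (head_coef alpha j * \prod_(i | i != j) t i) *: b j).
Proof.
have mono (s : 'S_m.+1) :
    fl_eval b (lnormed [seq fl_var K (s i) | i : 'I_m.+1]) =
    (\prod_(i | i != s ord0) t i) *: iter m (rmul e) (b (s ord0)).
  rewrite fl_eval_lnormed -map_comp.
  rewrite (eq_map (g := fun i => b (s i))); last first.
    by move=> i; rewrite /= fl_eval_var.
  rewrite enum_ordSl /= -map_comp.
  rewrite (foldl_generated (e := e) ann (t := fun i => t (s (lift ord0 i)))); last first.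
    by move=> i; apply: bt_e.
  rewrite size_enum_ord big_enum /=; congr (_ *: _).
  rewrite (reindex_inj (@perm_inj _ s)) /=.
  rewrite (eq_bigl (fun i => i != ord0)); last first.
    by move=> i; rewrite (inj_eq perm_inj).
  by rewrite [RHS]big_mkcond big_ord_recl /= mul1r.
rewrite fl_eval_sum (eq_bigr _ (fun s _ => congr1 _ (mono s))) linear_sum.
rewrite (partition_big (fun s : 'S_m.+1 => s ord0) predT) //=.
apply: eq_bigr => j _; rewrite linearZ /= -scalerA /head_coef scaler_suml.
by apply: eq_bigr => s /eqP ->.
Qed.

(** * The image of a multilinear polynomial *)

Unset Implicit Arguments.
Set Strict Implicit.
Set Printing Implicit Defensive.

Theorem theorem12 (K : fieldType) (n : nat) (L : leibnizVectType K)
    (hL : null_filiform L n) (m : nat) (hm : (0 < m)%N)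
    (f : freeLeibniz K) (hf : multilinear m f) :
  [\/ fl_image L m f = [set 0],
      fl_image L m f = [set` lbpow L m] |
      fl_image L m f = [set` lbpow L m.+1] ] /\
  exists W : {vspace L}, fl_image L m f = [set` W].
Proof.
suff image : [\/ fl_image L m f = [set 0],
      fl_image L m f = [set` lbpow L m] |
      fl_image L m f = [set` lbpow L m.+1] ].
  split=> //; case: image => ->; last 2 first.
  - by exists (lbpow L m).
  - by exists (lbpow L m.+1).
  - exists 0%VS; apply/seteqP; split=> x /=; rewrite memv0; first by move=> ->.
    by move/eqP.
case: m hm hf => // m _ [alpha ->] {f}.
have [e gen] := codim1_generator hL.
have ann := lbpow2_right_annihilates hL gen.
set f := \sum_s _; set c := head_coef alpha.
set R := iter m (rmul e).
have R0 : R 0 = 0 by rewrite /R linear0.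
have evalE (a : m.+1.-tuple L) (t : 'I_m.+1 -> K) :
    (forall i, tnth a i - t i *: e \in lbpow L 2) ->
    fl_eval (nth 0 a) f = R (\sum_j (c j * \prod_(i | i != j) t i) *: tnth a j).
  move=> at_e; rewrite /f (eval_multilinear (e := e) ann _ (t := t)).
    by congr R; apply: eq_bigr => j _; rewrite (tnth_nth 0).
  by move=> i; rewrite -tnth_nth.
have coord (a : m.+1.-tuple L) :
    exists t : 'I_m.+1 -> K, forall i, tnth a i - t i *: e \in lbpow L 2.
  have [t at_e] := boolp.choice (fun i => mem_generated gen (tnth a i)).
  by exists t.
have [/forallP c0|] := boolP [forall j, c j == 0].
  apply: Or31; apply/seteqP; split=> [v [a ->] | _ ->] /=.
    have [t /evalE ->] := coord a.
    rewrite big1 => [|j _]; first exact: R0.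
    by rewrite (eqP (c0 j)) mul0r scale0r.
  exists [tuple 0 | _ < m.+1]; rewrite (evalE _ (fun=> 0)).
    rewrite big1 => [|j _]; first exact: esym R0.
    by rewrite (eqP (c0 j)) mul0r scale0r.
  by move=> i; rewrite tnth_mktuple scale0r subr0 mem0v.
rewrite negb_forall => /existsP[k ck0].
set C := \sum_j c j.
(* Only the k-th summand involves w, and its scalar factor is c_k, hence the
   division by c_k; every other summand contributes c_j t e. *)
have reach (t : K) (w : L) : w \in lbpow L 2 ->
    fl_image L m.+1 f (R ((C * t) *: e + w)).
  move=> wL; pose a := [tuple if j == k then t *: e + (c k)^-1 *: w else e | j < m.+1].
  exists a; rewrite (evalE a (fun i => if i == k then t else 1)); last first.
    move=> i; rewrite tnth_mktuple; case: eqP => _.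
      by rewrite addrC addKr memvZ.
    by rewrite scale1r subrr mem0v.
  congr R; rewrite (bigD1 k) //= tnth_mktuple eqxx big1 => [|i /negPf -> //].
  rewrite mulr1 scalerDr !scalerA mulfV // scale1r addrAC; congr (_ + _).
  rewrite /C (bigD1 k) //= mulrDl scalerDl; congr (_ + _).
  rewrite mulr_suml scaler_suml.
  apply: eq_bigr => j /negPf jk.
  rewrite tnth_mktuple jk (bigD1 k) ?eqxx 1?eq_sym ?jk //= big1 ?mulr1 //.
  by move=> i /andP[_ /negPf ->].
have [C0|Cn0] := eqVneq C 0.
  apply: Or33; apply/seteqP; split=> [v [a ->] | v] /=.
    have [t at_e] := coord a; rewrite (evalE a t) //.
    rewrite -[m.+2]/(2 + m)%N; apply/(mem_lbpow_iter gen ann 1).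
    eexists; last by [].
    (* As C = 0, replacing each a_j by a_j - t_j e does not change the sum. *)
    have eP : \sum_j (c j * \prod_(i | i != j) t i) *: (t j *: e) = 0.
      rewrite -[RHS](scale0r e) -(mul0r (\prod_i t i)) -C0 /C mulr_suml scaler_suml.
      apply: eq_bigr => j _; rewrite scalerA -mulrA; congr ((_ * _) *: _).
      by rewrite [RHS](bigD1 j) //= mulrC.
    have -> : \sum_j (c j * \prod_(i | i != j) t i) *: tnth a j =
        \sum_j (c j * \prod_(i | i != j) t i) *: (tnth a j - t j *: e).
      under [RHS]eq_bigr => j _ do rewrite scalerBr.
      by rewrite sumrB eP subr0.
    by apply: memv_suml => j _; rewrite memvZ.
  rewrite -[m.+2]/(2 + m)%N => /(mem_lbpow_iter gen ann 1)[w wL ->].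
  by have := reach 0 w wL; rewrite mulr0 scale0r add0r.
apply: Or32; apply/seteqP; split=> [v [a ->] | v] /=.
  have [t at_e] := coord a; rewrite (evalE a t) //.
  rewrite -[m.+1]/(1 + m)%N; apply/(mem_lbpow_iter gen ann 0).
  by eexists; last by []; rewrite memvf.
rewrite -[m.+1]/(1 + m)%N => /(mem_lbpow_iter gen ann 0)[x _ ->].
have [t xL] := mem_generated gen x.
by have := reach (C^-1 * t) _ xL; rewrite mulVKf // addrC subrK.
Qed.
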